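(* Let $d$ be a positive integer, let $N_1\leq\cdots\leq N_d$ be positive integers, and set $N=N_1\cdots N_{d-1}$. Then the set of typical nonnegative ranks of nonnegative tensors of format $N_1\times\cdots\times N_d$ is $$\{r\in\mathbb{Z}\mid \mathrm{grank}_{\mathbb{C}}(N_1,\ldots,N_d)\leq r\leq N\}.$$
   Context: Let $\mathbb{R}_{\geq 0}=\{x\in\mathbb{R}\mid x\geq 0\}$. For $S\in\{\mathbb{R}_{\geq 0},\mathbb{R},\mathbb{C}\}$, $S^{N_1\times\cdots\times N_d}$ denotes the set of arrays $T=(t_{i_1\cdots i_d})$, $1\leq i_j\leq N_j$, with entries in $S$ ($N_1\times\cdots\times N_d$ tensors over $S$). An element of $\mathbb{R}_{\geq 0}^{N_1\times\cdots\times N_d}$ is called a nonnegative tensor of format $N_1\times\cdots\times N_d$. A nonzero $T\in S^{N_1\times\cdots\times N_d}$ has $S$-rank 1 if there are vectors $v_j=(v_{j1},\ldots,v_{jN_j})^\top\in S^{N_j}$, $1\leq j\leq d$, with $t_{i_1\cdots i_d}=\prod_{j=1}^d v_{ji_j}$ for all $(i_1,\ldots,i_d)$. In general the $S$-rank of $T\in S^{N_1\times\cdots\times N_d}$ is the minimum number $r$ such that $T$ is a sum of $r$ tensors of $S$-rank 1 (the empty sum being zero, so the zero tensor has $S$-rank 0). The $\mathbb{R}_{\geq 0}$-rank is called the nonnegative rank. Let $\mathbb{F}=\mathbb{R}$ if $S=\mathbb{R}_{\geq 0}$ or $S=\mathbb{R}$, and $\mathbb{F}=\mathbb{C}$ if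 $S=\mathbb{C}$; $\mathbb{F}^{N_1\times\cdots\times N_d}$ carries the Euclidean topology of $\mathbb{F}^{N_1\cdots N_d}$. An integer $r$ is a typical $S$-rank of $N_1\times\cdots\times N_d$ tensors if the set of elements of $S^{N_1\times\cdots\times N_d}$ of $S$-rank $r$ contains a nonempty Euclidean open subset of $\mathbb{F}^{N_1\times\cdots\times N_d}$. A typical $\mathbb{R}_{\geq 0}$-rank is called a typical nonnegative rank. It is known that there is exactly one typical $\mathbb{C}$-rank of $N_1\times\cdots\times N_d$ tensors over $\mathbb{C}$; it is called the generic rank and denoted $\mathrm{grank}_{\mathbb{C}}(N_1,\ldots,N_d)$. The empty product (the value of $N$ when $d=1$) is $1$. *)

(* Defs.v *)
From HB Require Import structures.
From mathcomp Require Import all_boot all_order all_algebra.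
From mathcomp Require Import complex.
From mathcomp Require Import all_classical all_reals all_analysis.

Set Implicit Arguments.
Unset Strict Implicit.
Unset Printing Implicit Defensive.

Import Order.TTheory GRing.Theory Num.Theory.
Import numFieldNormedType.Exports.

Local Open Scope classical_set_scope.
Local Open Scope ring_scope.

Definition multi_index (d : nat) (N : 'I_d -> nat) : Type :=
  {dffun forall j : 'I_d, 'I_(N j)}.

(* The index type is finite, so the product topology carried by this type is
   the Euclidean topology of F^(N_1 ... N_d). *)
Definition tensor (F : numFieldType) (d : nat) (N : 'I_d -> nat) : Type :=
  {ptws multi_index N -> F}.

(* In the definitions below, [S : set F] is the set of allowed entries:
   [nonneg_reals R] inside F = R, or [setT] inside F = R or F = R[i]. *)
Section Rank.
Context {F : numFieldType} (S : set F) {d : nat} {N : 'I_d -> nat}.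

Definition tensor_over (T : tensor F N) : Prop := forall i, S (T i).

Definition rank_one (T : tensor F N) : Prop :=
  (exists i, T i != 0) /\
  exists v : forall j : 'I_d, 'I_(N j) -> F,
    (forall j k, S (v j k)) /\
    (forall i : multi_index N, T i = \prod_(j < d) v j (i j)).

Definition sum_of_rank_one (T : tensor F N) (r : nat) : Prop :=
  exists P : 'I_r -> tensor F N,
    (forall k, rank_one (P k)) /\ (forall i, T i = \sum_(k < r) P k i).

Definition has_rank (T : tensor F N) (r : nat) : Prop :=
  sum_of_rank_one T r /\
  (forall s : nat, sum_of_rank_one T s -> (r <= s)%N).

End Rank.

Definition typical_rank (F : numFieldType) (S : set F) (d : nat)
    (N : 'I_d -> nat) (r : nat) : Prop :=
  exists U : set (tensor F N),
    [/\ open U, U !=set0 &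
        U `<=` [set T : tensor F N | tensor_over S T /\ has_rank S T r]].

Definition nonneg_reals (R : realType) : set R := [set x | 0 <= x].

(* [xget 0 A] is a chosen element of [A] if [A] is nonempty and 0 otherwise.
   There is exactly one typical rank over the complex numbers R[i], so this is
   that rank and the default value is irrelevant. *)
Definition grank (R : realType) (d : nat) (N : 'I_d -> nat) : nat :=
  xget 0%N [set r | typical_rank (F := R[i]) setT N r].

(* Main.v *)
Require Import Defs.
From HB Require Import structures.
From mathcomp Require Import all_boot all_order all_algebra.
From mathcomp Require Import complex closed_field.
From mathcomp Require Import ordered_qelim.
From mathcomp Require qe_rcf.
From mathcomp Require Import all_classical all_reals all_analysis.

Set Implicit Arguments.
Unset Strict Implicit.
Unset Printing Implicit Defensive.

Import Order.TTheory GRing.Theory Num.Theory.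
Import numFieldNormedType.Exports.

Local Open Scope classical_set_scope.
Local Open Scope ring_scope.

(** Write C_r for the set of nonnegative tensors of nonnegative rank at most r,
    and n for the product of all the N_j except the largest one.

    The set C_r is the image of a polynomial map h on a real affine space: it
    consists of the sums of r products of squares.  By quantifier elimination
    over real closed fields this image is described by sign conditions on
    finitely many polynomials; away from the zero locus of their product H,
    each sign is locally constant, so every point h p with H (h p) != 0 is
    interior to C_r ([real_image_generically_open]).  The same map over the
    complex numbers has as image the tensors of complex rank at most r, and
    elimination over an algebraically closed field shows that this image either
    contains the complement of a hypersurface or lies in a hypersurface
    ([closed_image_generic_or_thin]).  Hence there is exactly one typical
    complex rank, the least r for which the first case holds.

    Both situations are compared by polynomial identities, since a complex
    polynomial is determined by its values at the real points.  If r is smaller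
    than the generic rank, C_r lies in a real hypersurface and has no interior.
    Otherwise H does not vanish identically on the image of h; on a line through
    a point p of the parameter space and a point q with H (h q) != 0 there are
    only finitely many zeros, so the interior of C_r is dense in C_r
    ([nonneg_rank_le_interior_dense]).

    Typical ranks are at most n, because cutting a tensor into its fibres along
    the last mode writes it as a sum of n products.  Suppose now that r + 1 is
    at least the generic rank and not typical.  Then the interior of C_(r+1) is
    contained in the closure of C_r, so by density C_(r+1) is as well, and, as
    C_(s+1) = C_s + C_1, so is every C_s ([closure_nonneg_rank_le]).  This is
    impossible for r < n.  Consider the n multi-indices whose last coordinate is
    the sum of the others modulo the largest dimension N_d.  Two of them always
    differ in at least two places, so a nonnegative product that is large at two
    of them is also large at a position outside of this code.  The indicator
    tensor of the code therefore has a neighbourhood that does not meet C_r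
    ([rank_near_code]). *)

(** * Polynomial functions *)

(** Polynomial functions are handled semantically: over an infinite field a
    polynomial is determined by its values, and this form composes with any
    parametrization and any index type. *)
Inductive polyfun (F : comNzRingType) (I : Type) : ((I -> F) -> F) -> Prop :=
| polyfun_const c : polyfun (fun=> c)
| polyfun_coord i : polyfun (fun x => x i)
| polyfunD f g : polyfun f -> polyfun g -> polyfun (fun x => f x + g x)
| polyfunM f g : polyfun f -> polyfun g -> polyfun (fun x => f x * g x).

Section Polyfun.
Variables (F : comNzRingType) (I : Type).
Implicit Types f g : (I -> F) -> F.

Lemma polyfun_sum (K : Type) (s : seq K) (P : pred K)
    (f_ : K -> (I -> F) -> F) :
  (forall k, polyfun (f_ k)) ->
  polyfun (fun x : I -> F => \sum_(k <- s | P k) f_ k x).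
Proof.
move=> pf; elim: s => [|k s IHs].
  by under eq_fun do rewrite big_nil; exact: polyfun_const.
under eq_fun do rewrite big_cons.
by case: (P k) => //; exact: polyfunD.
Qed.

Lemma polyfun_prod (K : Type) (s : seq K) (P : pred K)
    (f_ : K -> (I -> F) -> F) :
  (forall k, polyfun (f_ k)) ->
  polyfun (fun x : I -> F => \prod_(k <- s | P k) f_ k x).
Proof.
move=> pf; elim: s => [|k s IHs].
  by under eq_fun do rewrite big_nil; exact: polyfun_const.
under eq_fun do rewrite big_cons.
by case: (P k) => //; exact: polyfunM.
Qed.

Lemma polyfunN f : polyfun f -> polyfun (fun x => - f x).
Proof.
move=> pf; under eq_fun do rewrite -mulN1r.
by apply: polyfunM => //; exact: polyfun_const.
Qed.

Lemma polyfunX f n : polyfun f -> polyfun (fun x => f x ^+ n).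
Proof.
move=> pf; elim: n => [|n IHn]; first exact: polyfun_const.
by under eq_fun do rewrite exprS; exact: polyfunM.
Qed.

Lemma polyfunMn f n : polyfun f -> polyfun (fun x => f x *+ n).
Proof.
move=> pf; under eq_fun do rewrite -mulr_natl.
by apply: polyfunM => //; exact: polyfun_const.
Qed.

Lemma polyfun_comp (J : Type) f (h : (J -> F) -> I -> F) :
  polyfun f -> (forall i, polyfun (h^~ i)) -> polyfun (fun y => f (h y)).
Proof.
move=> pf ph; elim: pf => [c|i|f1 f2 _ pf1 _ pf2|f1 f2 _ pf1 _ pf2].
- exact: polyfun_const.
- exact: ph.
- exact: polyfunD.
- exact: polyfunM.
Qed.


(** On a line a polynomial function is a polynomial in one variable; all the
    density arguments below are reduced to one variable in this way. *)
Lemma polyfun_line f (x y : I -> F) : polyfun f ->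
  exists q : {poly F}, forall t, f (fun i => x i + t * (y i - x i)) = q.[t].
Proof.
elim=> [c|i|f1 f2 _ [q1 e1] _ [q2 e2]|f1 f2 _ [q1 e1] _ [q2 e2]].
- by exists c%:P => t; rewrite hornerC.
- by exists ((x i)%:P + 'X * (y i - x i)%:P) => t; rewrite !hornerE.
- by exists (q1 + q2) => t; rewrite e1 e2 hornerD.
- by exists (q1 * q2) => t; rewrite e1 e2 hornerM.
Qed.

End Polyfun.


Section PolyfunNumField.
Variables (F : numFieldType) (I : Type).
Implicit Types f g : (I -> F) -> F.

(** The numbers e / 2, e / 3, ... are more numerous than the roots of q. *)
Lemma nonroot_small (q : {poly F}) (e : F) : q != 0 -> 0 < e ->
  exists t, [/\ 0 < t, t < e & q.[t] != 0].
Proof.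
move=> q0 e0; pose u (k : nat) := e / k.+2%:R.
have u_gt0 k : 0 < u k by rewrite divr_gt0.
have u_lt k : u k < e by rewrite ltr_pdivrMr// ltr_pMr// ltr1n.
have u_inj : injective u.
  move=> k l /(mulfI (lt0r_neq0 e0))/invr_inj/eqP.
  by rewrite eqr_nat => /eqP[].
have [/hasP[k _ qk]|/hasPn rootu] :=
    boolP (has (fun k => q.[u k] != 0) (iota 0 (size q))).
  by exists (u k).
pose rs := [seq u k | k <- iota 0 (size q)].
have rsq : all (root q) rs.
  by apply/allP => _ /mapP[k kq ->]; have /negPn := rootu _ kq.
have := max_poly_roots q0 rsq.
by rewrite map_inj_uniq ?iota_uniq// size_map size_iota ltnn => /(_ isT).
Qed.

(** Zariski-open nonempty sets meet: on the line joining two points where f and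
    g do not vanish, both are nonzero polynomials in one variable. *)
Lemma polyfun_neq0M f g x y : polyfun f -> polyfun g -> f x != 0 -> g y != 0 ->
  exists z, f z * g z != 0.
Proof.
move=> pf pg fx gy.
have [p ep] := polyfun_line x y pf; have [q eq] := polyfun_line x y pg.
have p0 : p != 0.
  apply: contraNneq fx => p0; have := ep 0; rewrite p0 horner0 => <-.
  by apply/eqP; congr f; apply/funext => i; rewrite mul0r addr0.
have q0 : q != 0.
  apply: contraNneq gy => q0; have := eq 1; rewrite q0 horner0 => <-.
  by apply/eqP; congr g; apply/funext => i; rewrite mul1r addrC subrK.
have [t [_ _ pqt]] := nonroot_small (mulf_neq0 p0 q0) ltr01.
by exists (fun i => x i + t * (y i - x i)); rewrite ep eq -hornerM.
Qed.

(** The limit is taken along an arbitrary family of points, so that the lemma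
    covers both continuity on the space of tensors and continuity along a
    line in a space of parameters, which carries no topology. *)
Lemma cvg_polyfun f (X : Type) (G : set_system X) (h : X -> I -> F) x :
  Filter G -> polyfun f -> (forall i, h^~ i @ G --> x i) ->
  f \o h @ G --> f x.
Proof.
move=> FG pf hx; elim: pf => [c|i|f1 f2 _ pf1 _ pf2|f1 f2 _ pf1 _ pf2].
- exact: cvg_cst.
- exact: hx.
- exact: cvgD.
- exact: cvgM.
Qed.

End PolyfunNumField.

Lemma cvg_ptws (I : Type) (T : topologicalType) (X : Type) (G : set_system X)
    (h : X -> {ptws I -> T}) (x : {ptws I -> T}) :
  Filter G -> (forall i, (fun y => h y i) @ G --> x i) -> h @ G --> x.
Proof.
move=> FG hx; apply/cvg_sup => i A /= [B [[C oC <-] Cx BA]].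
by apply: filterS BA _; apply: hx; exact: open_nbhs_nbhs.
Qed.

Lemma cvg_ptws_coord (I : eqType) (T : topologicalType) (i : I)
    (x : {ptws I -> T}) : (fun y : {ptws I -> T} => y i) @ x --> x i.
Proof. exact: (@proj_continuous I (fun=> T) i x). Qed.

(** * Density of the nonvanishing locus *)

Section Density.
Variables (F : numFieldType) (I : eqType) (J : Type).

Lemma continuous_polyfun (f : {ptws I -> F} -> F) : polyfun f -> continuous f.
Proof.
move=> pf x; apply: (@cvg_polyfun _ _ _ _ (nbhs x) id x (nbhs_filter x) pf)
  => i.
exact: cvg_ptws_coord.
Qed.

Lemma open_polyfun_neq0 (f : {ptws I -> F} -> F) : polyfun f ->
  open [set x | f x != 0].
Proof.
move=> /continuous_polyfun cf; rewrite openE => x fx0.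
by apply: (@cvgr_neq0 _ _ _ (nbhs x) _ f (f x)) => //; exact: cf.
Qed.

(** A condition f <> 0 that holds somewhere on the image of a polynomial map h
    holds arbitrarily close to each point h p: move from p towards a good point
    q, where f (h q) <> 0, along a line. *)
Lemma polyfun_map_dense (h : (J -> F) -> {ptws I -> F}) f
    (U : set {ptws I -> F}) p q :
  (forall i, polyfun (h^~ i)) -> polyfun f -> nbhs (h p) U -> f (h q) != 0 ->
  exists2 p', U (h p') & f (h p') != 0.
Proof.
move=> ph pf Up fq.
have [r er] := polyfun_line p q (polyfun_comp pf ph).
have r0 : r != 0.
  apply: contraNneq fq => r0; have := er 1; rewrite r0 horner0 => <-.
  by apply/eqP; congr (f (h _)); apply/funext => j; rewrite mul1r addrC subrK.
pose l t j : F := p j + t * (q j - p j).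
have hl : h \o l @ (0 : F) --> h p.
  apply: (@cvg_ptws _ _ _ (nbhs (0 : F)) (h \o l) _ (nbhs_filter 0)) => i.
  apply: (@cvg_polyfun _ _ _ _ (nbhs (0 : F)) l p (nbhs_filter 0) (ph i)) => j.
  rewrite -[X in _ --> X](addr0 (p j)) -[X in _ + X](mul0r (q j - p j)).
  by apply: cvgD; [exact: cvg_cst|apply: cvgM; [exact: cvg_id|exact: cvg_cst]].
have /nbhs_ballP[e /= e0 eU] := hl _ Up.
have [t [t0 te rt]] := nonroot_small r0 e0.
exists (l t); last by rewrite er.
by apply: (eU t); rewrite /ball/= sub0r normrN gtr0_norm.
Qed.

End Density.

(** * Images of polynomial maps *)

Section ImageFormula.
Variables (F : fieldType) (I J : finType).

(** In the formulas below the variables of index < #|I| stand for a point x of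
    the target and the #|J| following ones for a point of the source. *)
Definition env_of (x : I -> F) : seq F := [seq x i | i <- enum I].

Lemma nth_env_of x i : (env_of x)`_(enum_rank i) = x i.
Proof.
by rewrite (nth_map i) -?cardE ?ltn_ord// nth_enum_rank.
Qed.

Lemma polyfun_nth_env_of k : polyfun (fun x => (env_of x)`_k).
Proof.
have [kI|kI] := ltnP k #|I|; last first.
  rewrite (_ : (fun x => _) = fun=> 0); first exact: polyfun_const.
  by apply/funext => x; rewrite nth_default// size_map -cardE.
have -> : k = enum_rank (enum_val (Ordinal kI)) by rewrite enum_valK.
under eq_fun do rewrite nth_env_of; exact: polyfun_coord.
Qed.

Lemma polyfun_eval (t : GRing.term F) : GRing.rterm t ->
  polyfun (fun x => GRing.eval (env_of x) t).
Proof.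
elim: t => //=.
- by move=> k _; exact: polyfun_nth_env_of.
- by move=> c _; exact: polyfun_const.
- by move=> n _; exact: polyfun_const.
- by move=> t1 IH1 t2 IH2 /andP[/IH1 ? /IH2 ?]; exact: polyfunD.
- by move=> t IHt /IHt; exact: polyfunN.
- by move=> t IHt n /IHt; exact: polyfunMn.
- by move=> t1 IH1 t2 IH2 /andP[/IH1 ? /IH2 ?]; exact: polyfunM.
- by move=> t IHt n /IHt; exact: polyfunX.
Qed.

Lemma polyfun_term (f : (J -> F) -> F) : polyfun f ->
  exists t : GRing.term F, forall e : seq F,
    GRing.eval e t = f (fun j => e`_(#|I| + enum_rank j)).
Proof.
elim=> [c|j|f1 f2 _ [t1 e1] _ [t2 e2]|f1 f2 _ [t1 e1] _ [t2 e2]].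
- by exists (GRing.Const c).
- by exists (GRing.Var _ (#|I| + enum_rank j)).
- by exists (GRing.Add t1 t2) => e /=; rewrite e1 e2.
- by exists (GRing.Mul t1 t2) => e /=; rewrite e1 e2.
Qed.

Lemma holds_foldr_And (K : eqType) (s : seq K) (g : K -> GRing.formula F) e :
  GRing.holds e (foldr (fun k => GRing.And (g k)) (GRing.Bool true) s) <->
  forall k, k \in s -> GRing.holds e (g k).
Proof.
elim: s => [|k s IHs] //=; split=> [[gk /IHs gs] l|gs].
  by rewrite in_cons => /predU1P[->//|/gs].
split; first by apply: gs; rewrite mem_head.
by apply/IHs => l ls; apply: gs; rewrite in_cons ls orbT.
Qed.

(** The image of a polynomial map is definable by an existential formula; this
    is what makes quantifier elimination applicable. *)
Lemma image_formula (h : (J -> F) -> I -> F) : (forall i, polyfun (h^~ i)) ->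
  exists f : GRing.formula F, forall x : I -> F,
    GRing.holds (env_of x) f <-> exists p, forall i, x i = h p i.
Proof.
move=> ph; have [t et] := choice (fun i => polyfun_term (ph i)).
pose g i := GRing.Equal (GRing.Var F (enum_rank i)) (t i).
exists (foldr GRing.Exists
  (foldr (fun i => GRing.And (g i)) (GRing.Bool true) (enum I))
  (iota #|I| #|J|)) => x.
split=> [/GRing.foldExistsP[e ex /holds_foldr_And eg]|[p xp]].
  exists (fun j => e`_(#|I| + enum_rank j)) => i.
  rewrite -et; have /= <- := eg i (mem_enum _ _).
  by rewrite -nth_env_of ex// !inE mem_iota leqNgt ltn_ord.
apply/GRing.foldExistsP; exists (env_of x ++ [seq p j | j <- enum J]).
  move=> k; rewrite !inE mem_iota negb_and -leqNgt -ltnNge nth_cat.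
  rewrite size_map -cardE; case: ltnP => //= Ik Jk.
  rewrite nth_default; last by rewrite size_map -cardE.
  by rewrite nth_default// size_map -cardE leq_subRL.
apply/holds_foldr_And => i _ /=; rewrite et nth_cat size_map -cardE ltn_ord.
rewrite nth_env_of xp; congr (h _ i); apply/funext => j.
rewrite nth_cat size_map -cardE ltnNge leq_addr/= addKn.
by rewrite (nth_map j) -?cardE ?ltn_ord// nth_enum_rank.
Qed.

End ImageFormula.

Section ClosedFieldImage.
Variables (F : numClosedFieldType) (I J : finType).

(** Each atom t1 == t2 is either identically true or false outside of the
    hypersurface t1 - t2 = 0. *)
Lemma qf_generically_constant (f : GRing.formula F) :
  GRing.qf_form f -> GRing.rformula f ->
  exists2 H : (I -> F) -> F, polyfun H & (exists x, H x != 0) /\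
    exists b, forall x, H x != 0 -> GRing.qf_eval (env_of x) f = b.
Proof.
pose good (B : (I -> F) -> bool) :=
  exists2 H : (I -> F) -> F, polyfun H & (exists x, H x != 0) /\
    exists b, forall x, H x != 0 -> B x = b.
have two (op : bool -> bool -> bool) B1 B2 : good B1 -> good B2 ->
    good (fun x => op (B1 x) (B2 x)).
  move=> [H1 pH1 [[x1 H1x] [b1 e1]]] [H2 pH2 [[x2 H2x] [b2 e2]]].
  exists (fun x => H1 x * H2 x); first exact: polyfunM.
  split; first exact: polyfun_neq0M H1x H2x.
  exists (op b1 b2) => x; rewrite mulf_eq0 negb_or => /andP[H1x' H2x'].
  by rewrite e1// e2.
rewrite -/(good (fun x => GRing.qf_eval (env_of x) f)).
elim: f => //=.
- move=> b _ _; exists (fun=> 1); first exact: polyfun_const.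
  by split; [exists (fun=> 0); rewrite oner_neq0|exists b].
- move=> t1 t2 _ /andP[r1 r2].
  pose H (x : I -> F) := GRing.eval (env_of x) t1 - GRing.eval (env_of x) t2.
  have pH : polyfun H.
    by apply: polyfunD; [|apply: polyfunN]; exact: polyfun_eval.
  have [[x Hx]|H0] := pselect (exists x, H x != 0).
    exists H => //; split; first by exists x.
    by exists false => y; rewrite subr_eq0 => /negbTE.
  exists (fun=> 1); first exact: polyfun_const.
  split; first by exists (fun=> 0); rewrite oner_neq0.
  exists true => x _; rewrite -subr_eq0; apply/negPn/negP => Hx.
  by apply: H0; exists x.
- move=> f1 IH1 f2 IH2 /andP[q1 q2] /andP[r1 r2].
  exact: (two andb _ _ (IH1 q1 r1) (IH2 q2 r2)).
- move=> f1 IH1 f2 IH2 /andP[q1 q2] /andP[r1 r2].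
  exact: (two orb _ _ (IH1 q1 r1) (IH2 q2 r2)).
- move=> f1 IH1 f2 IH2 /andP[q1 q2] /andP[r1 r2].
  exact: (two implb _ _ (IH1 q1 r1) (IH2 q2 r2)).
- move=> f IHf q r; have [H pH [Hx [b e]]] := IHf q r.
  by exists H => //; split => //; exists (~~ b) => x /e ->.
Qed.

Lemma closed_image_qf (h : (J -> F) -> I -> F) : (forall i, polyfun (h^~ i)) ->
  exists2 f : GRing.formula F, GRing.qf_form f && GRing.rformula f &
    forall x : I -> F, GRing.qf_eval (env_of x) f <-> exists p, x = h p.
Proof.
move=> ph; have [f ef] := image_formula ph.
have rf := GRing.to_rform_rformula f.
have wf := @ClosedFieldQE.wf_ex_elim F.
exists (GRing.quantifier_elim (@ClosedFieldQE.ex_elim F) (GRing.to_rform f)).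
  exact: (GRing.quantifier_elim_wf wf rf).
move=> x; have fP := GRing.quantifier_elim_rformP wf
  (ClosedFieldQE.holds_ex_elim (@GRing.solve_monicpoly F)) (env_of x) rf.
apply: (iff_trans (iff_sym (rwP fP))).
apply: (iff_trans (GRing.to_rformP _ _)).
apply: (iff_trans (ef x)); split=> -[p xp]; exists p.
  exact/funext.
by move=> i; rewrite xp.
Qed.

(** A substitute for the theorem of Chevalley on constructible images: outside
    of a hypersurface the eliminated formula is constantly true or constantly
    false. *)
Lemma closed_image_generic_or_thin (h : (J -> F) -> I -> F) :
  (forall i, polyfun (h^~ i)) ->
  exists2 H : (I -> F) -> F, polyfun H & (exists x, H x != 0) /\
    ((forall x, H x != 0 -> exists p, x = h p) \/ (forall p, H (h p) = 0)).
Proof.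
move=> /closed_image_qf[f /andP[q r] ef].
have [H pH [Hx [[] e]]] := qf_generically_constant q r.
  by exists H => //; split => //; left => x /e/ef.
exists H => //; split => //; right=> p; apply/eqP/negPn/negP => /e.
by have [_ ->] := ef (h p); last by exists p.
Qed.

End ClosedFieldImage.

Section RealClosedImage.
Variables (R : realType) (I J : finType).

(** Since the parametrizations below use squares instead of sign conditions,
    the formulas to be eliminated contain no inequalities; those appear only as
    the result of the elimination. *)
Fixpoint ordered_formula (f : GRing.formula R) : ord.formula R :=
  match f with
  | GRing.Bool b => ord.Bool b
  | GRing.Equal t1 t2 => ord.Equal t1 t2
  | GRing.Unit t => ord.Unit t
  | GRing.And f1 f2 => ord.And (ordered_formula f1) (ordered_formula f2)
  | GRing.Or f1 f2 => ord.Or (ordered_formula f1) (ordered_formula f2)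
  | GRing.Implies f1 f2 => ord.Implies (ordered_formula f1) (ordered_formula f2)
  | GRing.Not f1 => ord.Not (ordered_formula f1)
  | GRing.Exists k f1 => ord.Exists k (ordered_formula f1)
  | GRing.Forall k f1 => ord.Forall k (ordered_formula f1)
  end.

Lemma holds_ordered_formula e f :
  ord.holds e (ordered_formula f) <-> GRing.holds e f.
Proof.
elim: f e => //=.
- by move=> f1 IH1 f2 IH2 e; rewrite IH1 IH2.
- by move=> f1 IH1 f2 IH2 e; rewrite IH1 IH2.
- by move=> f1 IH1 f2 IH2 e; rewrite IH1 IH2.
- by move=> f IHf e; rewrite IHf.
- by move=> k f IHf e; split=> -[x /IHf fx]; exists x.
- by move=> k f IHf e; split=> fx x; apply/IHf.
Qed.

(** If f is not identically zero, H = f does it, by continuity; otherwise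
    H = 1. *)
Lemma polyfun_sg_near (f : {ptws I -> R} -> R) : polyfun f ->
  exists2 H : {ptws I -> R} -> R, polyfun H & (exists x, H x != 0) /\
    forall x, H x != 0 -> \forall y \near x, Num.sg (f y) = Num.sg (f x).
Proof.
move=> pf; have [[x fx]|f0] := pselect (exists x, f x != 0).
  exists f => //; split; first by exists x.
  move=> y fy; have cf := continuous_polyfun pf (x := y).
  have [fy_lt0|fy_gt0|fy0] := ltgtP (f y) 0; last by rewrite fy0 eqxx in fy.
    near=> z; rewrite !ltr0_sg//; near: z.
    exact: (@cvgr_lt _ _ (nbhs y) _ f (f y) cf).
  near=> z; rewrite !gtr0_sg//; near: z.
  exact: (@cvgr_gt _ _ (nbhs y) _ f (f y) cf).
exists (fun=> 1); first exact: polyfun_const.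
split; first by exists (fun=> 0); rewrite oner_neq0.
have {}f0 x : f x = 0.
  by apply/eqP/negPn/negP => fx; apply: f0; exists x.
by move=> x _; near=> y; rewrite !f0.
Unshelve. all: by end_near. Qed.

(** A quantifier-free formula only depends on the signs of finitely many
    polynomials, and H is the product of the nonzero ones. *)
Lemma qf_locally_constant (f : ord.formula R) :
  ord.qf_form f -> ord.rformula f ->
  exists2 H : {ptws I -> R} -> R, polyfun H & (exists x, H x != 0) /\
    forall x, H x != 0 ->
      \forall y \near x, ord.qf_eval (env_of y) f = ord.qf_eval (env_of x) f.
Proof.
pose good (B : {ptws I -> R} -> bool) :=
  exists2 H : {ptws I -> R} -> R, polyfun H & (exists x, H x != 0) /\
    forall x, H x != 0 -> \forall y \near x, B y = B x.
have atom (op : R -> bool) t1 t2 : GRing.rterm t1 && GRing.rterm t2 ->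
  good (fun x =>
    op (Num.sg (GRing.eval (env_of x) t1 - GRing.eval (env_of x) t2))).
  move=> /andP[r1 r2].
  have pt : polyfun (fun x : I -> R =>
      GRing.eval (env_of x) t1 - GRing.eval (env_of x) t2).
    by apply: polyfunD; [|apply: polyfunN]; exact: polyfun_eval.
  have [H pH [Hx HB]] := polyfun_sg_near pt.
  by exists H => //; split => // x /HB; apply: filterS => y ->.
have two (op : bool -> bool -> bool) B1 B2 : good B1 -> good B2 ->
    good (fun x => op (B1 x) (B2 x)).
  move=> [H1 pH1 [[x1 H1x] e1]] [H2 pH2 [[x2 H2x] e2]].
  exists (fun x => H1 x * H2 x); first exact: polyfunM.
  split; first exact: polyfun_neq0M H1x H2x.
  move=> x; rewrite mulf_eq0 negb_or => /andP[/e1 + /e2].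
  by apply: filterS2 => y -> ->.
rewrite -/(good (fun x => ord.qf_eval (env_of x) f)).
elim: f => //=.
- move=> b _ _; exists (fun=> 1); first exact: polyfun_const.
  split; first by exists (fun=> 0); rewrite oner_neq0.
  by move=> x _; near=> y.
- move=> t1 t2 _ /(atom (eq_op^~ 0)).
  by under eq_fun do rewrite sgr_eq0 subr_eq0.
- move=> t1 t2 _ /(atom (eq_op^~ (-1))).
  by under eq_fun do rewrite sgr_cp0 subr_lt0.
- move=> t1 t2 _ /(atom (predC1 1)).
  by under eq_fun do rewrite /= sgr_cp0 subr_gt0 -leNgt.
- move=> f1 IH1 f2 IH2 /andP[q1 q2] /andP[r1 r2].
  exact: (two andb _ _ (IH1 q1 r1) (IH2 q2 r2)).
- move=> f1 IH1 f2 IH2 /andP[q1 q2] /andP[r1 r2].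
  exact: (two orb _ _ (IH1 q1 r1) (IH2 q2 r2)).
- move=> f1 IH1 f2 IH2 /andP[q1 q2] /andP[r1 r2].
  exact: (two implb _ _ (IH1 q1 r1) (IH2 q2 r2)).
- move=> f IHf q r; have [H pH [Hx e]] := IHf q r.
  by exists H => //; split => // x /e; apply: filterS => y ->.
Unshelve. all: by end_near. Qed.

Lemma real_image_qf (h : (J -> R) -> I -> R) : (forall i, polyfun (h^~ i)) ->
  exists2 f : ord.formula R, ord.qf_form f && ord.rformula f &
    forall x : I -> R, ord.qf_eval (env_of x) f <-> exists p, x = h p.
Proof.
move=> ph; have [f ef] := image_formula ph.
have rf := ord.to_rform_rformula (ordered_formula f).
exists (ord.quantifier_elim
    (fun k bc => qe_rcf.qfr_to_formula (qe_rcf.wproj k bc))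
    (ord.to_rform (ordered_formula f))).
  exact: (ord.quantifier_elim_wf (@qe_rcf.wf_QE_wproj R) rf).
move=> x; have fP := ord.quantifier_elim_rformP (@qe_rcf.wf_QE_wproj R)
  (@qe_rcf.valid_QE_wproj R) (env_of x) rf.
apply: (iff_trans (iff_sym (rwP fP))).
apply: (iff_trans (ord.to_rformP _ _)).
apply: (iff_trans (holds_ordered_formula _ _)).
apply: (iff_trans (ef x)); split=> -[p xp]; exists p.
  exact/funext.
by move=> i; rewrite xp.
Qed.

(** A semialgebraic set is open outside of a hypersurface. *)
Lemma real_image_generically_open (h : (J -> R) -> {ptws I -> R}) :
  (forall i, polyfun (h^~ i)) ->
  exists2 H : {ptws I -> R} -> R, polyfun H & (exists x, H x != 0) /\
    forall p, H (h p) != 0 -> nbhs (h p) (range h).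
Proof.
move=> /real_image_qf[f /andP[q r] ef].
have [H pH [Hx e]] := qf_locally_constant q r.
exists H; first exact: pH.
split; first exact: Hx.
move=> p Hp; pose B (y : {ptws I -> R}) := ord.qf_eval (env_of y) f =
  ord.qf_eval (env_of (h p)) f.
have ep : nbhs (h p) B.
  exact: (e _ Hp).
refine (@filterS _ (nbhs (h p)) (nbhs_filter (h p)) B _ _ ep) => y yp.
have : ord.qf_eval (env_of (h p)) f by apply/ef; exists p.
by rewrite -yp => /ef[p' ->]; exists p'.
Qed.

End RealClosedImage.

(** * Real and complex polynomial functions *)

Section RealComplex.
Variables (R : realType) (I : Type).
Local Notation "x %:C" := (real_complex R x) (format "x %:C").

Lemma polyfun_complexify (f : (I -> R) -> R) : polyfun f ->
  exists2 g : (I -> R[i]) -> R[i], polyfun g &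
    forall x, g (fun i => (x i)%:C) = (f x)%:C.
Proof.
elim=> [c|i|f1 f2 _ [g1 p1 e1] _ [g2 p2 e2]|f1 f2 _ [g1 p1 e1] _ [g2 p2 e2]].
- by exists (fun=> c%:C) => //; exact: polyfun_const.
- by exists (fun x => x i) => //; exact: polyfun_coord.
- exists (fun x => g1 x + g2 x); first exact: polyfunD.
  by move=> x; rewrite e1 e2 rmorphD.
- exists (fun x => g1 x * g2 x); first exact: polyfunM.
  by move=> x; rewrite e1 e2 rmorphM.
Qed.

Lemma polyfun_Re_Im (g : (I -> R[i]) -> R[i]) : polyfun g ->
  polyfun (fun x : I -> R => complex.Re (g (fun i => (x i)%:C))) /\
  polyfun (fun x : I -> R => complex.Im (g (fun i => (x i)%:C))).
Proof.
elim=> [c|i|g1 g2 _ [r1 i1] _ [r2 i2]|g1 g2 _ [r1 i1] _ [r2 i2]].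
- by split; exact: polyfun_const.
- by split; [exact: polyfun_coord|exact: polyfun_const].
- split.
    rewrite (_ : (fun x => _) = (fun x => complex.Re (g1 (fun i => (x i)%:C)) +
      complex.Re (g2 (fun i => (x i)%:C)))); first exact: polyfunD.
    by apply/funext => x; case: (g1 _) => ? ?; case: (g2 _).
  rewrite (_ : (fun x => _) = (fun x => complex.Im (g1 (fun i => (x i)%:C)) +
    complex.Im (g2 (fun i => (x i)%:C)))); first exact: polyfunD.
  by apply/funext => x; case: (g1 _) => ? ?; case: (g2 _).
- split.
    rewrite (_ : (fun x => _) = (fun x =>
      complex.Re (g1 (fun i => (x i)%:C)) * complex.Re (g2 (fun i => (x i)%:C))
      + - (complex.Im (g1 (fun i => (x i)%:C)) *
           complex.Im (g2 (fun i => (x i)%:C))))).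
      by apply: polyfunD; [|apply: polyfunN]; exact: polyfunM.
    by apply/funext => x; case: (g1 _) => ? ?; case: (g2 _).
  rewrite (_ : (fun x => _) = (fun x =>
    complex.Re (g1 (fun i => (x i)%:C)) * complex.Im (g2 (fun i => (x i)%:C))
    + complex.Im (g1 (fun i => (x i)%:C)) *
      complex.Re (g2 (fun i => (x i)%:C)))).
    by apply: polyfunD; exact: polyfunM.
  by apply/funext => x; case: (g1 _) => ? ?; case: (g2 _).
Qed.

(** The point z = u + i v lies on the complex line through the real points u and
    u + v, and the restriction of g to that line vanishes at all real values of
    the parameter. *)
Lemma polyfun_eq0_on_reals (g : (I -> R[i]) -> R[i]) : polyfun g ->
  (forall x : I -> R, g (fun i => (x i)%:C) = 0) -> forall z, g z = 0.
Proof.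
move=> pg g0 z.
pose x i := (complex.Re (z i))%:C.
pose y i := (complex.Re (z i) + complex.Im (z i))%:C.
have [q eq] := polyfun_line x y pg.
have q0 : q = 0.
  apply/eqP/negPn/negP => /nonroot_small/(_ ltr01)[t [t_gt0 _ qt]].
  have /complex_realP[s ts] : t \is Num.real by exact: gtr0_real.
  move: qt; rewrite -eq ts /x /y.
  under eq_fun do rewrite -rmorphB -rmorphM -rmorphD.
  by rewrite (g0 (fun i => _)) eqxx.
have := eq 'i%C; rewrite q0 horner0 => <-; congr g; apply/funext => i.
by rewrite /x /y rmorphD addrAC subrr add0r -complexE.
Qed.

End RealComplex.

(** * Sums of product tensors *)

Section SumOfProducts.
Variables (F : numFieldType) (S : set F) (d : nat) (N : 'I_d -> nat).

(** Zero products are allowed here, contrary to the rank-one terms in the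
    definition of the rank; the bounds [rank_le] are thus images of maps defined
    everywhere.  The terms are indexed by any finite type, since disjoint unions
    and subtypes of index sets occur. *)
Definition sum_of_products (K : finType) (T : tensor F N) : Prop :=
  exists2 v : K -> forall j : 'I_d, 'I_(N j) -> F, (forall k j x, S (v k j x)) &
    forall i : multi_index N, T i = \sum_k \prod_j v k j (i j).

Definition rank_le (r : nat) : set (tensor F N) := sum_of_products 'I_r.

Hypotheses (d_gt0 : (0 < d)%N) (S0 : S 0).

(** Missing terms are filled by zero products. *)
Lemma sum_of_products_rank_le (K : finType) r T :
  (#|K| <= r)%N -> sum_of_products K T -> rank_le r T.
Proof.
move=> Kr [v Sv Tv].
pose w (k : nat) j x : F :=
  if insub k : option 'I_#|K| is Some l then v (enum_val l) j x else 0.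
exists (fun k : 'I_r => w k) => [k j x|i]; first by rewrite /w; case: insubP.
rewrite Tv; transitivity (\sum_(k < #|K|) \prod_j w k j (i j)).
  rewrite [LHS](big_enum_val (A := K) (fun k => \prod_j v k j (i j))).
  by apply: eq_bigr => k _; apply: eq_bigr => j _; rewrite /w valK.
rewrite (big_ord_widen r (fun k => \prod_j w k j (i j)) Kr).
rewrite big_mkcond; apply: eq_bigr => k _; case: ifPn => // kK.
by rewrite (bigD1 (Ordinal d_gt0))//= /w insubF ?mul0r// (negbTE kK).
Qed.

Lemma rank_leW r s : (r <= s)%N -> rank_le r `<=` rank_le s.
Proof. by move=> rs T; apply: sum_of_products_rank_le; rewrite card_ord. Qed.

Lemma rank_leD r s T U : rank_le r T -> rank_le s U ->
  rank_le (r + s) (fun i => T i + U i).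
Proof.
move=> [v Sv Tv] [w Sw Uw].
apply: (@sum_of_products_rank_le ('I_r + 'I_s)%type).
  by rewrite card_sum !card_ord.
exists (fun k => match k with inl l => v l | inr l => w l end).
  by case.
by move=> i; rewrite big_sumType/= -Tv -Uw.
Qed.

Lemma rank_leS_inv r T : rank_le r.+1 T ->
  exists A B, [/\ rank_le r A, rank_le 1 B & T = (fun i => A i + B i)].
Proof.
move=> [v Sv Tv].
exists (fun i => \sum_(k < r) \prod_j v (widen_ord (leqnSn r) k) j (i j)).
exists (fun i => \prod_j v ord_max j (i j)); split.
- by exists (fun k => v (widen_ord (leqnSn r) k)).
- by exists (fun=> v ord_max) => // i; rewrite big_ord1.
- by apply/funext => i; rewrite Tv big_ord_recr.
Qed.

(** Discarding the zero products leaves a sum of at most r rank-one tensors. *)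
Lemma sum_of_rank_oneP r T : rank_le r T <->
  exists2 s, (s <= r)%N & sum_of_rank_one S T s.
Proof.
split=> [[v Sv Tv]|[s sr [P [P1 TP]]]]; last first.
  apply: (rank_leW sr); have [v vP] := choice (fun k => (P1 k).2).
  exists v => [k j x|i]; first exact: (vP k).1.
  by rewrite TP; apply: eq_bigr => k _; rewrite (vP k).2.
pose nz : {pred 'I_r} := fun k =>
  `[< exists i : multi_index N, \prod_j v k j (i j) != 0 >].
pose K : finType := {k | k \in nz}.
exists #|K|; first by rewrite card_sig -[leqRHS]card_ord max_card.
exists (fun l i => \prod_j v (val (enum_val l : K)) j (i j)); split.
  move=> l; split; first by case: (enum_val l) => k /= /asboolP.
  by exists (v (val (enum_val l : K))).
move=> i; rewrite Tv (bigID nz)/= [X in _ + X]big1 ?addr0; last first.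
  move=> k /asboolPn nzk; apply/eqP/negPn/negP => Pk; apply: nzk.
  by exists i.
rewrite -(big_enum_val (A := K) (fun k : K => \prod_j v (val k) j (i j))).
rewrite [RHS](eq_bigl xpredT)//.
exact: (big_sub nz (fun k => \prod_j v k j (i j))).
Qed.

Lemma has_rankP r T :
  has_rank S T r <-> rank_le r T /\ forall s, rank_le s T -> (r <= s)%N.
Proof.
split=> [[Tr minr]|[/sum_of_rank_oneP[s sr Ts] minr]]; split.
- by apply/sum_of_rank_oneP; exists r.
- by move=> s /sum_of_rank_oneP[t ts /minr rt]; exact: leq_trans rt ts.
- have rs : (r <= s)%N by apply: minr; apply/sum_of_rank_oneP; exists s.
  by have -> : r = s by apply/eqP; rewrite eqn_leq rs sr.
- by move=> t Tt; apply: minr; apply/sum_of_rank_oneP; exists t.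
Qed.

End SumOfProducts.

Section SquareParametrization.
Variables (F : numFieldType) (d : nat) (N : 'I_d -> nat) (r : nat).

Definition factor_index : finType := ('I_r * {j : 'I_d & 'I_(N j)})%type.

(** Every nonnegative real and every complex number is a square, so this one map
    parametrizes both nonnegative and complex ranks at most r, without any
    constraint on the parameters. *)
Definition sum_of_square_products (p : factor_index -> F) : tensor F N :=
  fun i => \sum_k \prod_j p (k, Tagged (fun j => 'I_(N j)) (i j)) ^+ 2.

Lemma polyfun_sum_of_square_products i :
  polyfun (fun p => sum_of_square_products p i).
Proof.
apply: polyfun_sum => k; apply: polyfun_prod => j.
by apply: polyfunX; exact: polyfun_coord.
Qed.

Lemma rank_le_squares (S : set F) : (forall x, S x <-> exists y, x = y ^+ 2) ->
  rank_le S r = range sum_of_square_products.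
Proof.
move=> Ssq; apply/seteqP; split=> T.
  move=> [v Sv Tv].
  have sq (k : factor_index) : exists y, v k.1 (tag k.2) (tagged k.2) = y ^+ 2.
    exact/Ssq.
  have [p vp] := choice sq.
  exists p => //; apply/funext => i; rewrite Tv.
  by apply: eq_bigr => k _; apply: eq_bigr => j _; rewrite -vp.
move=> [p _ <-].
exists (fun k j x => p (k, Tagged (fun j => 'I_(N j)) x) ^+ 2) => // k j x.
by apply/Ssq; exists (p (k, Tagged (fun j => 'I_(N j)) x)).
Qed.

End SquareParametrization.

(** * Fibres along the last mode and a code of distance two *)

Section Slices.
Variables (d : nat) (N : 'I_d.+1 -> nat).
Hypothesis N_gt0 : forall j, (0 < N j)%N.
Implicit Types i : multi_index N.

Lemma ord_last_proper (j : 'I_d.+1) : (j.+1 < d.+1)%N = (j != ord_max).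
Proof. by rewrite ltnS ltn_neqAle -ltnS ltn_ord andbT. Qed.

Definition prefix_pred (j : 'I_d.+1) : pred 'I_(N j) :=
  if j == ord_max then pred1 (Ordinal (N_gt0 j)) else predT.

(** A choice of all coordinates but the last one, encoded as the multi-index
    whose last coordinate is 0. *)
Definition prefix : finType := {i : multi_index N | i \in family prefix_pred}.

Lemma card_prefix : #|prefix| = (\prod_(j < d.+1 | (j.+1 < d.+1)%N) N j)%N.
Proof.
rewrite card_sig; apply: etrans (card_family prefix_pred) _.
rewrite foldrE big_map big_enum/= [RHS]big_mkcond; apply: eq_bigr => j _.
rewrite ord_last_proper /prefix_pred; case: (j == ord_max) => /=.
  by rewrite card1.
by rewrite cardT -cardE card_ord.
Qed.

Definition chop i : multi_index N :=
  [ffun j => if j == ord_max then Ordinal (N_gt0 j) else i j].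

Lemma chop_prefix i : chop i \in family prefix_pred.
Proof.
apply/familyP => j; rewrite ffunE /prefix_pred.
by case: eqP => //= _; rewrite inE.
Qed.

Lemma prefixP (k l : prefix) :
  (forall j, j != ord_max -> val k j = val l j) -> k = l.
Proof.
move=> kl; apply/val_inj/ffunP => j.
have [jm|] := eqVneq j ord_max; last exact: kl.
have /familyP/(_ j) := valP k; have /familyP/(_ j) := valP l.
by rewrite /prefix_pred jm eqxx => /eqP -> /eqP ->.
Qed.

(** T is the sum, over all prefixes, of the tensor product of the basis vectors
    of that prefix with the corresponding fibre of T. *)
Lemma rank_le_slices (F : numFieldType) (S : set F) (T : tensor F N) :
  S 0 -> S 1 -> tensor_over S T ->
  rank_le S (\prod_(j < d.+1 | (j.+1 < d.+1)%N) N j) T.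
Proof.
move=> S0 S1 ST; apply: (@sum_of_products_rank_le _ _ _ _ _ _ prefix) => //.
  by rewrite card_prefix.
pose v (k : prefix) j (x : 'I_(N j)) : F :=
  if j == ord_max then
    if [pick i : multi_index N | (chop i == val k) && (i j == x)] is Some i
    then T i else 0
  else (x == val k j)%:R.
exists v => [k j x|i]; rewrite /v.
  by case: ifP => _; [case: pickP|case: (x == _)].
pose k : prefix := Sub (chop i) (chop_prefix i).
rewrite (bigD1 k)//= [X in _ + X]big1 ?addr0 => [|l lk]; last first.
  have [j /andP[jm kj]|same] :=
      pickP [pred j | (j != ord_max) && (i j != val l j)].
    by rewrite (bigD1 j)//= (negbTE jm) (negbTE kj) mul0r.
  case/eqP: lk; apply: prefixP => j jm; apply/eqP; rewrite ffunE (negbTE jm).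
  by move: (same j); rewrite /= jm eq_sym => /negbFE.
rewrite (bigD1 ord_max)//= eqxx big1 => [|j jm]; last first.
  by rewrite (negbTE jm) ffunE (negbTE jm) eqxx.
rewrite mulr1; case: pickP => [i' /andP[/eqP ii' /eqP im]|/(_ i)].
  congr T; apply/ffunP => j; have [->//|jm] := eqVneq j ord_max.
  have := congr1 (fun f : multi_index N => f j) ii'.
  by rewrite !ffunE (negbTE jm).
by rewrite !eqxx.
Qed.

Definition checksum i := (\sum_(j | j != ord_max) i j)%N.

(** The code of the multi-indices that satisfy one parity check: the last
    coordinate is the sum of the others modulo the last dimension. *)
Definition in_code i : bool := i ord_max == (checksum i %% N ord_max)%N :> nat.

Definition encode i : multi_index N :=
  [ffun j => if j == ord_max then Ordinal (ltn_pmod (checksum i) (N_gt0 j))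
             else i j].

Lemma encode_in_code i : in_code (encode i).
Proof.
rewrite /in_code ffunE eqxx /= /checksum; apply/eqP; congr (_ %% _)%N.
by apply: eq_bigr => j jm; rewrite ffunE (negbTE jm).
Qed.

Lemma encode_inj : injective (fun k : prefix => encode (val k)).
Proof.
move=> k l kl; apply: prefixP => j jm.
by have := congr1 (fun f : multi_index N => f j) kl; rewrite !ffunE (negbTE jm).
Qed.

Hypothesis N_max : forall j, (N j <= N ord_max)%N.

(** A coordinate of a code word is determined by the others: the checksum gives
    it modulo the largest dimension N_d, and it is less than N_j <= N_d. *)
Lemma code_distance i i' j0 : in_code i -> in_code i' ->
  (forall j, j != j0 -> i j = i' j) -> i = i'.
Proof.
move=> /eqP ci /eqP ci' ii'; apply/ffunP => j.
have [->|/ii'//] := eqVneq j j0; apply: val_inj => /=.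
have [j0m|j0m] := eqVneq j0 ord_max.
  rewrite j0m ci ci'; congr (_ %% _)%N; apply: eq_bigr => l lm.
  by rewrite ii'// j0m.
have : (checksum i = checksum i' %[mod N ord_max])%N.
  by rewrite -ci -ci' ii'// eq_sym.
rewrite /checksum !(bigD1 j0 j0m)/= (eq_bigr (fun l => i' l : nat)).
  move/eqP; rewrite eqn_modDr => /eqP.
  by rewrite !modn_small// (leq_trans (ltn_ord _)).
by move=> l /andP[_ lj0]; rewrite ii'.
Qed.

Definition exchange i i' j0 : multi_index N :=
  [ffun j => if j == j0 then i' j else i j].

(** With fewer than n terms, each of the n code words has a term that is at
    least e = 1 / (n + 2) there, and two code words i and i' share such a term
    P.  Exchanging one coordinate in which they differ leaves the product
    P i * P i' unchanged but moves both positions out of the code, where P is at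
    most T and hence less than e; so e * e < e * e. *)
Lemma rank_near_code (R : realType) (T : tensor R N) (r : nat) :
  let n := (\prod_(j < d.+1 | (j.+1 < d.+1)%N) N j)%N in
  (forall i, `|T i - (in_code i)%:R| < n.+2%:R^-1) ->
  rank_le (@nonneg_reals R) r T -> (n <= r)%N.
Proof.
move=> n Tn [v v_ge0 Tv]; rewrite leqNgt; apply/negP => rn.
pose e : R := n.+2%:R^-1.
have e_gt0 : 0 < e by rewrite invr_gt0.
pose P k i := \prod_j v k j (i j).
have P_ge0 k i : 0 <= P k i by apply: prodr_ge0 => j _; exact: v_ge0.
(* T exceeds 1 - e at a code word, and n terms below e add up to less. *)
have big (l : prefix) : exists k, e <= P k (encode (val l)).
  have [[k ek]|small] := pselect (exists k, e <= P k (encode (val l))).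
    by exists k.
  have : T (encode (val l)) <= n%:R * e.
    rewrite Tv (@le_trans _ _ (\sum_(k < r) e))//.
      apply: ler_sum => k _; rewrite leNgt; apply/negP => ek.
      by apply: small; exists k; exact: ltW.
    rewrite sumr_const card_ord mulr_natl.
    by rewrite ler_wpMn2l//; [exact: ltW|exact: ltnW].
  have := Tn (encode (val l)); rewrite encode_in_code -/e.
  rewrite ltr_distl => /andP[+ _] => /lt_le_trans/[apply].
  rewrite ltrBlDr -[X in _ + X]mul1r -mulrDl natr1 /e ltr_pdivlMr// mul1r.
  by rewrite ltr_nat ltnNge leqnSn.
have [c ec] := choice big.
have cNinj : ~ injective c.
  move=> /leq_card; rewrite card_ord card_prefix -/n => nr.
  by rewrite ltnNge nr in rn.
apply: cNinj => l l' cll'; apply: contrapT => ll'.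
set i := encode (val l); set i' := encode (val l').
have ii' : i <> i' by move=> /encode_inj.
have [j0 /eqP ij0|same] := pickP [pred j | i j != i' j]; last first.
  by apply: ii'; apply/ffunP => j; apply/eqP; move: (same j) => /negbFE.
have off (a b : multi_index N) : in_code a -> a j0 <> b j0 ->
    P (c l) (exchange a b j0) < e.
  move=> ca ab; have : ~~ in_code (exchange a b j0).
    apply/negP => cs; apply: ab.
    rewrite (@code_distance a (exchange a b j0) j0)// ?ffunE ?eqxx// => j jj0.
    by rewrite ffunE (negbTE jj0).
  move=> cs; have := Tn (exchange a b j0); rewrite (negbTE cs) subr0.
  apply: le_lt_trans; apply: le_trans (ler_norm _).
  rewrite Tv (bigD1 (c l))//= lerDl; apply: sumr_ge0 => k _; exact: P_ge0.
have exch : P (c l) i * P (c l) i' =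
    P (c l) (exchange i i' j0) * P (c l) (exchange i' i j0).
  rewrite /P -!big_split/=; apply: eq_bigr => j _; rewrite !ffunE.
  by case: (j == j0) => //; rewrite mulrC.
have ei := ec l; have ei' : e <= P (c l) i' by rewrite cll' ec.
have : e * e < e * e; last by rewrite ltxx.
apply: (@le_lt_trans _ _ (P (c l) i * P (c l) i')).
  by apply: ler_pM => //; exact: ltW.
rewrite exch; apply: ltr_pM => //; apply: off => //; try exact: encode_in_code.
by move=> /esym.
Qed.

End Slices.

(** * The typical complex rank *)

Section ComplexTypicalRank.
Variables (R : realType) (d : nat) (N : 'I_d -> nat).
Hypothesis d_gt0 : (0 < d)%N.
Local Notation C := R[i].
Local Notation "x %:C" := (real_complex R x) (format "x %:C").

(** [generically_rank_le] and [thinly_rank_le] are the two alternatives for the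
    set of complex tensors of rank at most r: it contains the complement of a
    hypersurface, or is contained in a hypersurface. *)
Definition generically_rank_le (r : nat) : Prop :=
  exists2 H : tensor C N -> C, polyfun H & (exists T, H T != 0) /\
    forall T, H T != 0 -> rank_le setT r T.

Definition thinly_rank_le (r : nat) : Prop :=
  exists2 H : tensor C N -> C, polyfun H & (exists T, H T != 0) /\
    forall T, rank_le setT r T -> H T = 0.

Lemma polyfun_open_neq0 (F : numFieldType) (H : tensor F N -> F) U :
  polyfun H -> (exists T, H T != 0) -> open U -> U !=set0 ->
  exists2 T, U T & H T != 0.
Proof.
move=> pH [T0 HT0] oU [T UT].
apply: (@polyfun_map_dense F (multi_index N) (multi_index N) id H U T T0) => //.
- by move=> i; exact: polyfun_coord.
- exact: open_nbhs_nbhs.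
Qed.

Lemma complex_squares (x : C) : setT x <-> exists y, x = y ^+ 2.
Proof. by split=> // _; exists (sqrtC x); rewrite sqrtCK. Qed.

Lemma generically_or_thinly r : generically_rank_le r \/ thinly_rank_le r.
Proof.
have [H pH [HT [gen|thin]]] := closed_image_generic_or_thin
    (@polyfun_sum_of_square_products C d N r); [left|right]; exists H => //.
  split=> // T /gen[p ->]; rewrite (rank_le_squares _ _ complex_squares).
  by exists p.
by split=> // T; rewrite (rank_le_squares _ _ complex_squares) => -[p _ <-].
Qed.

Lemma generically_rank_leW r s : (r <= s)%N ->
  generically_rank_le r -> generically_rank_le s.
Proof.
move=> rs [H pH [HT gen]]; exists H => //; split => // T /gen.
exact: rank_leW.
Qed.

(** Nonempty open sets are not contained in a hypersurface.  So an open set of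
    tensors of rank r forces the first alternative for r and the second one for
    all smaller ranks; conversely the complement of two hypersurfaces is an open
    set of tensors of rank r. *)
Lemma typical_complex_rankP r : typical_rank (F := C) setT N r <->
  generically_rank_le r /\ forall s, generically_rank_le s -> (r <= s)%N.
Proof.
split=> [[U [oU U0 Ur]]|[gen minr]].
  have sub T : U T ->
      rank_le setT r T /\ forall s, rank_le setT s T -> (r <= s)%N.
    by move=> /Ur[_ /has_rankP]; exact.
  split=> [|s [H pH [HT gen]]].
    have [//|[H pH [HT thin]]] := generically_or_thinly r.
    have [T /sub[/thin -> _]] := polyfun_open_neq0 pH HT oU U0.
    by rewrite eqxx.
  by have [T /sub[_ +] /gen] := polyfun_open_neq0 pH HT oU U0; exact.
have [G pG [GT low]] : exists2 G : tensor C N -> C, polyfun G &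
    (exists T, G T != 0) /\
    forall T s, rank_le setT s T -> (s < r)%N -> G T = 0.
  case: r gen minr => [|r] gen minr.
    exists (fun=> 1); first exact: polyfun_const.
    by split => //; exists (fun=> 0); rewrite oner_neq0.
  have [/minr|[G pG [GT thin]]] := generically_or_thinly r.
    by rewrite ltnn.
  exists G; first exact: pG.
  split; first exact: GT.
  move=> T s Ts; rewrite ltnS => sr.
  by apply: thin; exact: (rank_leW d_gt0 I sr Ts).
have [H pH [[T0 HT0] genH]] := gen; have [T1 GT1] := GT.
have [T HGT] := polyfun_neq0M pH pG HT0 GT1.
exists [set T | H T * G T != 0]; split.
- by apply: open_polyfun_neq0; exact: polyfunM.
- by exists T.
move=> U /=; rewrite mulf_eq0 negb_or => /andP[/genH Ur GU]; split => //.
apply/has_rankP => //; split => // s Us; rewrite leqNgt; apply/negP => sr.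
by move: GU; rewrite (low _ _ Us sr) eqxx.
Qed.

Lemma generically_rank_le_grank r : (exists s, generically_rank_le s) ->
  generically_rank_le r <-> (grank R N <= r)%N.
Proof.
move=> [s gs].
have ex : exists s, `[< generically_rank_le s >] by exists s; exact/asboolP.
have [m /asboolP gm minm] := ex_minnP ex.
have -> : grank R N = m.
  apply: xget_unique.
    apply/typical_complex_rankP; split => // t gt.
    by apply: minm; exact/asboolP.
  move=> t /typical_complex_rankP[gt mint]; apply/eqP.
  by rewrite eqn_leq mint// minm//; exact/asboolP.
split; first by move=> gr; apply: minm; exact/asboolP.
by move=> mr; exact: generically_rank_leW gm.
Qed.

(** * Interior of the sets of bounded nonnegative rank *)

Local Notation nonneg_rank_le := (rank_le (N := N) (@nonneg_reals R)).

Lemma nonneg_squares (x : R) : nonneg_reals x <-> exists y, x = y ^+ 2.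
Proof.
split=> [x_ge0|[y ->]]; last exact: sqr_ge0.
by exists (Num.sqrt x); rewrite sqr_sqrtr.
Qed.

Lemma sum_of_square_products_complex r (p : factor_index N r -> R) i :
  sum_of_square_products (fun k => (p k)%:C) i =
  (sum_of_square_products p i)%:C.
Proof.
rewrite /sum_of_square_products rmorph_sum; apply: eq_bigr => k _.
by rewrite rmorph_prod; apply: eq_bigr => j _; rewrite rmorphXn.
Qed.

(** If the complex tensors of rank at most r satisfied an equation H = 0, the
    real and imaginary parts of H would be real equations for C_r; having
    nonempty interior, C_r only satisfies trivial ones, so H would vanish at all
    real tensors, hence everywhere. *)
Lemma generically_rank_le_interior r (T : tensor R N) :
  nbhs T (nonneg_rank_le r) -> generically_rank_le r.
Proof.
move=> nT; have [//|[H pH [[T0 HT0] thin]]] := generically_or_thinly r.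
have real0 (f : tensor R N -> R) : polyfun f ->
    (forall T, nonneg_rank_le r T -> f T = 0) -> forall T, f T = 0.
  move=> pf f0 U; apply/eqP/negPn/negP => fU.
  have [U' rU'] := @polyfun_open_neq0 _ f (interior (nonneg_rank_le r)) pf
    (ex_intro _ U fU) (@open_interior _ _) (ex_intro _ T nT).
  by rewrite f0 ?eqxx//; exact: interior_subset.
have [pRe pIm] := polyfun_Re_Im pH.
have H0 (U : tensor R N) : nonneg_rank_le r U -> H (fun i => (U i)%:C) = 0.
  rewrite (rank_le_squares _ _ nonneg_squares) => -[p _ <-]; apply: thin.
  rewrite (rank_le_squares _ _ complex_squares).
  exists (fun k => (p k)%:C) => //; apply/funext => i.
  exact: sum_of_square_products_complex.
case/eqP: HT0; apply: (polyfun_eq0_on_reals pH) => U.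
rewrite [LHS]complexE (real0 _ pRe) ?(real0 _ pIm) ?mulr0 ?addr0//.
- by move=> V /H0 ->.
- by move=> V /H0 ->.
Qed.

(** The exceptional hypersurface of [real_image_generically_open] does not
    contain the whole image when almost all complex tensors have rank at most r,
    and then it can be avoided by moving T slightly. *)
Lemma nonneg_rank_le_interior_dense r (T : tensor R N) (U : set (tensor R N)) :
  generically_rank_le r -> nonneg_rank_le r T -> nbhs T U ->
  exists2 T', U T' & nbhs T' (nonneg_rank_le r).
Proof.
move=> [G pG [[T1 GT1] gen]].
rewrite (rank_le_squares _ _ nonneg_squares) => -[p _ <-] Up.
have ph := @polyfun_sum_of_square_products R d N r.
have [H pH [[T0 HT0] int]] := real_image_generically_open ph.
have [[q Hq]|Hnone] :=
    pselect (exists q, H (@sum_of_square_products R d N r q) != 0).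
  have [p' Up' Hp'] := polyfun_map_dense ph pH Up Hq.
  by exists (sum_of_square_products p') => //; exact: int.
(* A real equation H = 0 for the image of h complexifies to an equation K = 0
   for all complex tensors of rank at most r, which contradicts [gen]. *)
exfalso.
have [K pK eK] := polyfun_complexify pH.
have pKh : polyfun (fun p => K (@sum_of_square_products C d N r p)).
  by apply: polyfun_comp => // i; exact: polyfun_sum_of_square_products.
have K0 q : K (@sum_of_square_products C d N r q) = 0.
  move: q; apply: (polyfun_eq0_on_reals pKh) => q.
  under [X in K X]funext do rewrite sum_of_square_products_complex.
  rewrite eK.
  have [->//|Hq] := eqVneq (H (@sum_of_square_products R d N r q)) 0.
  by exfalso; apply: Hnone; exists q.
have KT0 : K (fun i => (T0 i)%:C) != 0 by rewrite eK fmorph_eq0.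
have [V] := polyfun_neq0M pG pK GT1 KT0.
rewrite mulf_eq0 negb_or => /andP[/gen].
rewrite (rank_le_squares _ _ complex_squares) => -[q _ <-].
by rewrite K0 eqxx.
Qed.

Lemma nonneg_rank_le_tensor_over r (T : tensor R N) :
  nonneg_rank_le r T -> tensor_over (@nonneg_reals R) T.
Proof.
move=> [v v_ge0 Tv] i; rewrite Tv /nonneg_reals/=; apply: sumr_ge0 => k _.
by apply: prodr_ge0 => j _; exact: v_ge0.
Qed.

(** If passing from C_r to C_(r+1) does not enlarge the closure, no further
    summand does, because C_(s+1) = C_s + C_1 and translation by a tensor of C_1
    is continuous and maps C_r into C_(r+1). *)
Lemma closure_nonneg_rank_le r :
  generically_rank_le r.+1 ->
  interior (nonneg_rank_le r.+1) `<=` closure (nonneg_rank_le r) ->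
  forall s, nonneg_rank_le s `<=` closure (nonneg_rank_le r).
Proof.
move=> gr sub.
have subS : nonneg_rank_le r.+1 `<=` closure (nonneg_rank_le r).
  rewrite closureE => T rT B [clB subB]; apply: contrapT => BT.
  have nT : nbhs T (~` B).
    by apply: open_nbhs_nbhs; split => //; exact: closed_openC.
  have [T' BT' /sub] := nonneg_rank_le_interior_dense gr rT nT.
  by rewrite closureE => clT'; apply: BT'; exact: clT'.
elim=> [|s IHs].
  by move=> T /(rank_leW d_gt0 (lexx 0) (leq0n r)); exact: subset_closure.
move=> _ /rank_leS_inv[A [B [/IHs clA B1 ->]]].
have cl : closure (closure (nonneg_rank_le r)) (fun i => A i + B i).
  move=> U nU.
  have add_cont :
      (fun X : tensor R N => (fun i => X i + B i) : tensor R N) @ A -->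
      ((fun i => A i + B i) : tensor R N).
    apply: (@cvg_ptws _ _ _ (nbhs A) _ _ (nbhs_filter A)) => i.
    apply: (@cvgD _ _ _ (nbhs A) _ (fun X : tensor R N => X i) (fun=> B i)).
      exact: cvg_ptws_coord.
    exact: cvg_cst.
  have [X [rX UX]] := clA _ (add_cont _ nU).
  exists (fun i => X i + B i); split => //; apply: subS.
  by rewrite -[r.+1]addn1; apply: rank_leD => //; exact: lexx.
by rewrite -(closure_id _).1 in cl => //; exact: closed_closure.
Qed.

End ComplexTypicalRank.

(** * Typical nonnegative ranks *)

Lemma code_not_in_closure (R : realType) (d : nat) (N : 'I_d.+1 -> nat)
    (N_gt0 : forall j, (0 < N j)%N) (N_max : forall j, (N j <= N ord_max)%N)
    (r : nat) :
  (r < \prod_(j < d.+1 | (j.+1 < d.+1)%N) N j)%N ->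
  ~ closure (rank_le (@nonneg_reals R) r : set (tensor R N))
      (fun i => (in_code i)%:R).
Proof.
set n := (\prod_(j < _ | _) _)%N => rn cl.
pose T0 : tensor R N := fun i => (in_code i)%:R.
have near0 : nbhs T0 [set T : tensor R N |
    forall i, `|T i - (in_code i)%:R| < n.+2%:R^-1].
  apply: (@filter_forall _ _ _ (nbhs T0) (nbhs_filter T0)) => i.
  have /cvgrPdist_lt/(_ n.+2%:R^-1) := @cvg_ptws_coord _ R i T0.
  rewrite invr_gt0 ltr0Sn => /(_ isT).
  by apply: filterS => T; rewrite distrC.
have [T [Tr nearT]] := cl _ near0.
by have := rank_near_code N_gt0 N_max nearT Tr; rewrite leqNgt rn.
Qed.

Theorem theorem3p8 (R : realType) (d : nat) (N : 'I_d -> nat)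
    (d_gt0 : (0 < d)%N)
    (N_gt0 : forall j : 'I_d, (0 < N j)%N)
    (N_mono : forall i j : 'I_d, (i <= j)%N -> (N i <= N j)%N) :
  [set r : nat | typical_rank (@nonneg_reals R) N r] =
  [set r : nat | (grank R N <= r <= \prod_(j < d | (j.+1 < d)%N) N j)%N].
Proof.
case: d N d_gt0 N_gt0 N_mono => // d N d_gt0 N_gt0 N_mono.
have N_max j : (N j <= N ord_max)%N by apply: N_mono; exact: leq_ord.
set n := (\prod_(j < _ | _) _)%N.
pose C r : set (tensor R N) := rank_le (@nonneg_reals R) r.
have nn0 : nonneg_reals (0 : R) by exact: lexx.
have nn1 : nonneg_reals (1 : R) by exact: ler01.
have Cn T : tensor_over (@nonneg_reals R) T -> C n T by exact: rank_le_slices.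
have grankP r : generically_rank_le R N r <-> (grank R N <= r)%N.
  apply: generically_rank_le_grank => //; exists n, (fun=> 1).
    exact: polyfun_const.
  split; first by exists (fun=> 0); rewrite oner_neq0.
  by move=> T _; exact: rank_le_slices.
apply/seteqP; split=> r /=.
  move=> [U [oU [T UT] Ur]].
  have rankU V : U V -> C r V.
    by move=> /Ur[_ /(has_rankP d_gt0 nn0)[]].
  apply/andP; split.
    apply/grankP; apply: (@generically_rank_le_interior _ _ _ _ T).
    by apply: filterS rankU _; exact: open_nbhs_nbhs.
  have [/Cn Tn /(has_rankP d_gt0 nn0)[_ minr]] := Ur _ UT.
  exact: minr.
move=> /andP[/grankP gr rn].
have C0 : C r (fun=> 0).
  apply: (rank_leW d_gt0 nn0 (leq0n r)).
  by exists (fun=> fun _ _ => 0) => // i; rewrite big_ord0.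
have intC : interior (C r) !=set0.
  have [T _ Tr] := nonneg_rank_le_interior_dense gr C0 filterT.
  by exists T.
suff [U [oU U0 subU low]] : exists U, [/\ open U, U !=set0, U `<=` C r &
    forall s T, U T -> C s T -> (r <= s)%N].
  exists U; split => // T UT; split.
    exact: nonneg_rank_le_tensor_over (subU _ UT).
  apply/(has_rankP d_gt0 nn0); split; first exact: subU.
  by move=> s; exact: low.
case: r => [|r] in gr rn C0 intC *.
  by exists (interior (C 0%N)); split => //;
    [exact: open_interior|exact: interior_subset].
(* If this set were empty, the chain of closures would stop growing at r. *)
exists (interior (C r.+1) `&` ~` closure (C r)); split.
- by apply: openI; [exact: open_interior|exact/closed_openC/closed_closure].
- apply: contrapT => empty.
  apply: (@code_not_in_closure R d N N_gt0 N_max r rn).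
  apply: (closure_nonneg_rank_le d_gt0 gr _ (s := n)).
    by move=> T intT; apply: contrapT => clT; apply: empty; exists T.
  by apply: Cn => i; rewrite /nonneg_reals/= ler0n.
- by move=> T [/interior_subset].
- move=> s T [_ clT] sT; rewrite leqNgt ltnS; apply/negP => sr.
  by apply: clT; apply: subset_closure; exact: (rank_leW d_gt0 nn0 sr sT).
Qed.
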